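(* Let $n\geq 10$ be an integer with $n\equiv 1\pmod 3$. Let $\hat{L}$ be the $n\times n$ matrix $$\hat{L}=\frac{n-1}{3}I_n-\frac13\begin{bmatrix}0&\mathbf{e}'\\ \mathbf{e}&\mathbf{0}\end{bmatrix}+\begin{bmatrix}0&\mathbf{0}'\\ \mathbf{0}&P\end{bmatrix},$$ where $P$ is the $(n-1)\times(n-1)$ circulant matrix defined in the context. Then the rank of $\hat{L}$ is $n-3$.
   Context: The prime denotes transpose, $I_n$ is the identity matrix, and $\mathbf{e}$ denotes the all-ones column vector (here in $\mathbb{R}^{n-1}$). In the block matrices the blocks have sizes $1$ and $n-1$. For a vector $\mathbf{c}=(c_1,\dots,c_m)'$, $\operatorname{Circ}(\mathbf{c}')$ is the $m\times m$ circulant matrix with first row $(c_1,\dots,c_m)$ and each subsequent row the cyclic right shift by one of the previous row. Definition of $P$ (for $n\equiv 1\pmod 3$, $n\ge 10$). Let $\mathbf{e_i}$ be the $i$-th standard basis vector of $\mathbb{R}^{n-1}$ and $\mathbf{c_k}=\mathbf{e_{k+1}}+\mathbf{e_{n-k}}\in\mathbb{R}^{n-1}$, for $1\le k\le \frac{n-2}{2}$ if $n$ is even and $1\le k\le\frac{n-3}{2}$ if $n$ is odd. If $n$ is even, $P=\frac{1}{3(n-1)}\operatorname{Circ}(\mathbf{z_1}')$ with $$\mathbf{z_1}=(2n-n^2)\mathbf{e_1}+\sum_{k=1}^{\frac{n-4}{6}}\left(\frac{3n-18k+8}{2}\mathbf{c_{3k-2}}-\frac{3n-18k+4}{2}\mathbf{c_{3k-1}}+\mathbf{c_{3k}}\right)+\mathbf{c_{\frac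 n2-1}}.$$ If $n$ is odd, $P=\frac{1}{3(n-1)}\operatorname{Circ}(\mathbf{z_2}')$ with $$\mathbf{z_2}=(2n-n^2)\mathbf{e_1}+\sum_{k=1}^{\frac{n-1}{6}}\left(\frac{3n-18k+8}{2}\mathbf{c_{3k-2}}-\frac{3n-18k+4}{2}\mathbf{c_{3k-1}}\right)+\sum_{k=1}^{\frac{n-7}{6}}\mathbf{c_{3k}}+\mathbf{e_{\frac{n+1}{2}}}.$$ *)

(* Defs.v *)
From mathcomp Require Import all_boot all_order all_algebra.

Set Implicit Arguments.
Unset Strict Implicit.
Unset Printing Implicit Defensive.

Import GRing.Theory.
Local Open Scope ring_scope.

(* Entry j of the shifted row is the entry at the cyclic predecessor of j. *)
Definition cyclic_shift (R : Type) (m : nat) (r : 'rV[R]_m) : 'rV[R]_m :=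
  \row_j r 0 (ord_pred j).

Definition Circ (R : Type) (m : nat) (r : 'rV[R]_m) : 'M[R]_m :=
  \matrix_(i, j) iter i (@cyclic_shift R m) r 0 j.

(* The index i is 1-based: the j-th ordinal is the (j + 1)-th coordinate. *)
Definition basis_vec (R : realFieldType) (m i : nat) : 'cV[R]_m :=
  \col_(j < m) (j.+1 == i)%:R.

Definition c_vec (R : realFieldType) (n k : nat) : 'cV[R]_(n - 1) :=
  basis_vec R (n - 1) (k + 1) + basis_vec R (n - 1) (n - k).

(* The numerators may be negative, hence subtraction in R rather than in nat;
   the divisions %/ on nat are exact when n = 1 %[mod 3] has the relevant
   parity. *)
Definition a_coef (R : realFieldType) (n k : nat) : R :=
  (3 * n%:R - 18 * k%:R + 8) / 2.

Definition b_coef (R : realFieldType) (n k : nat) : R :=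
  (3 * n%:R - 18 * k%:R + 4) / 2.

Definition z1 (R : realFieldType) (n : nat) : 'cV[R]_(n - 1) :=
  (2 * n%:R - n%:R ^+ 2) *: basis_vec R (n - 1) 1
  + \sum_(1 <= k < ((n - 4) %/ 6).+1)
      (a_coef R n k *: c_vec R n (3 * k - 2)
       - b_coef R n k *: c_vec R n (3 * k - 1)
       + c_vec R n (3 * k))
  + c_vec R n (n %/ 2 - 1).

Definition z2 (R : realFieldType) (n : nat) : 'cV[R]_(n - 1) :=
  (2 * n%:R - n%:R ^+ 2) *: basis_vec R (n - 1) 1
  + \sum_(1 <= k < ((n - 1) %/ 6).+1)
      (a_coef R n k *: c_vec R n (3 * k - 2)
       - b_coef R n k *: c_vec R n (3 * k - 1))
  + \sum_(1 <= k < ((n - 7) %/ 6).+1) c_vec R n (3 * k)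
  + basis_vec R (n - 1) ((n + 1) %/ 2).

Definition P_mx (R : realFieldType) (n : nat) : 'M[R]_(n - 1) :=
  (3 * (n%:R - 1))^-1 *: Circ (if odd n then z2 R n else z1 R n)^T.

(* For n >= 1 the dimension 1 + (n - 1) is n; it is written this way to fit
   the block decomposition. *)
Definition Lhat (R : realFieldType) (n : nat) : 'M[R]_(1 + (n - 1)) :=
  let e : 'cV[R]_(n - 1) := const_mx 1 in
  ((n%:R - 1) / 3) *: 1%:M
  - 3^-1 *: block_mx 0 e^T e 0
  + block_mx 0 0 0 (P_mx R n).

(* Main.v *)
(** Write m = n - 1.  Up to the factor 1/3, the matrix is bordered by the hub
    row [m, -e'] and its rim block is C / m, where C is the circulant matrix
    whose first row w is 1, (3m - 6j - 1)/2, (6j - 3m - 1)/2 according to the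
    residue of j modulo 3.  Modulo x^m - 1, the product of w(x) with
    x^-1 + 1 + x is 3m minus a circulant T of rank at most 2, whence
    rank C >= m - 2.  Conversely the entries of w sum to m/3 over each residue
    class modulo 3, which gives three independent kernel vectors: the all-ones
    vector and two rim vectors that depend on the residue modulo 3 only and
    sum to zero over the three residues. *)
Require Import Defs.
From mathcomp Require Import all_boot all_order all_algebra.
From mathcomp Require Import zify ring.

Set Implicit Arguments.
Unset Strict Implicit.
Unset Printing Implicit Defensive.

Import GRing.Theory Num.Theory.
Local Open Scope ring_scope.

(** * The first row of the circulant on the rim *)

Definition rim (R : realFieldType) (m j : nat) : R :=
  match (j %% 3)%N with
  | 0 => 1
  | 1 => (3 * m%:R - 6 * j%:R - 1) / 2
  | _ => (6 * j%:R - 3 * m%:R - 1) / 2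
  end.

Section Rim.
Variable R : realFieldType.

Lemma rim0 (m k : nat) : rim R m (3 * k) = 1.
Proof. by rewrite /rim modnMr. Qed.

Lemma rim1 (m k : nat) :
  rim R m (3 * k).+1 = (3 * m%:R - 18 * k%:R - 7) / 2.
Proof.
rewrite /rim; have -> : ((3 * k).+1 %% 3 = 1)%N by lia.
by field.
Qed.

Lemma rim2 (m k : nat) :
  rim R m (3 * k).+2 = (18 * k%:R + 11 - 3 * m%:R) / 2.
Proof.
rewrite /rim; have -> : ((3 * k).+2 %% 3 = 2)%N by lia.
by field.
Qed.

(** A case split on the residue, put in the shape of an induction principle so that [elim/] accepts
    it. *)
Lemma mod3_ind (P : nat -> Prop) :
  (forall k, P (3 * k)%N) -> (forall k, P (3 * k).+1) ->
  (forall k, P (3 * k).+2) -> forall j, P j.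
Proof.
move=> P0 P1 P2 j; rewrite (divn_eq j 3) mulnC.
have : (j %% 3 < 3)%N by rewrite ltn_mod.
by case: (j %% 3)%N => [|[|[|//]]] _; rewrite ?addn0 ?addn1 ?addn2.
Qed.

(** As 3 divides [m], the reflection of [j] to [m - j] exchanges the residues 1 and 2, and it
    exchanges their affine formulas as well. *)
Lemma rim_sym (m j : nat) :
  (3 %| m)%N -> (j <= m)%N -> rim R m (m - j) = rim R m j.
Proof.
case/dvdnP => q ->; rewrite mulnC.
elim/mod3_ind: j => k le_km.
- have -> : (3 * q - 3 * k = 3 * (q - k))%N by lia.
  by rewrite !rim0.
- have -> : (3 * q - (3 * k).+1 = (3 * (q - k.+1)).+2)%N by lia.
  rewrite rim1 rim2 natrB; last by lia.
  by field.
- have -> : (3 * q - (3 * k).+2 = (3 * (q - k.+1)).+1)%N by lia.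
  rewrite rim1 rim2 natrB; last by lia.
  by field.
Qed.

Lemma sum_mod3 (q c : nat) (F : nat -> R) : (c < 3)%N ->
  \sum_(i < 3 * q | (i %% 3 == c)%N) F i = \sum_(0 <= k < q) F (3 * k + c)%N.
Proof.
move=> lt_c3; rewrite -(big_mkord (fun i => (i %% 3 == c)%N)).
elim: q => [|q IHq]; first by rewrite muln0 !big_geq.
rewrite big_nat_recr // -{}IHq.
have -> : (3 * q.+1 = (3 * q).+3)%N by lia.
rewrite big_mkcond /= !big_nat_recr //= -big_mkcond /=.
have -> : ((3 * q) %% 3 = 0)%N by lia.
have -> : ((3 * q).+1 %% 3 = 1)%N by lia.
have -> : ((3 * q).+2 %% 3 = 2)%N by lia.
case: c lt_c3 => [|[|[|//]]] _ /=; rewrite !addr0.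
- by rewrite addn0.
- by rewrite addn1.
- by rewrite addn2.
Qed.

Lemma sum_rim_class (q c : nat) : (c < 3)%N ->
  \sum_(i < 3 * q | (i %% 3 == c)%N) rim R (3 * q) i = q%:R.
Proof.
move=> lt_c3; rewrite sum_mod3 //.
(* Arithmetic progressions in closed form, with [m] independent of [t] so that induction on [t]
   works; [m = 3 * q] and [t = q] come afterwards. *)
have partial m t : \sum_(0 <= k < t) rim R m (3 * k + c) =
    match c with
    | 0 => t%:R
    | 1 => (3 * m%:R * t%:R - 9 * t%:R * (t%:R - 1) - 7 * t%:R) / 2
    | _ => (9 * t%:R * (t%:R - 1) + 11 * t%:R - 3 * m%:R * t%:R) / 2
    end.
  elim: t => [|t IHt].
    by rewrite big_geq //; case: c lt_c3 => [|[]] *; field.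
  rewrite big_nat_recr //= {}IHt.
  case: c lt_c3 => [|[|[|//]]] _; rewrite ?addn0 ?addn1 ?addn2.
  - by rewrite rim0; field.
  - by rewrite rim1; field.
  - by rewrite rim2; field.
rewrite partial natrM.
by case: c lt_c3 {partial} => [|[|[|//]]] _; field.
Qed.

(** The coefficients of w(x)(x^-1 + 1 + x). The slopes at residues 1 and 2 cancel, so a window
    without wrap-around sums to -6 if its middle index is divisible by 3 and to 3 otherwise; the
    jump at a window centred at 0 adds 3m. *)
Lemma rim_three_term (m k : nat) : (3 %| m)%N -> (0 < m)%N ->
  rim R m (k %% m) + rim R m (k.+1 %% m) + rim R m (k.+2 %% m)
  = 3 * m%:R * (k.+1 %% m == 0)%N%:R + 3 - 9 * (k.+1 %% 3 == 0)%N%:R.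
Proof.
move=> m3 m_gt0.
have modS d c : (c + k %% d = c + k %[mod d])%N by rewrite modnDmr.
have -> : (k.+1 %% 3 = (k %% m).+1 %% 3)%N.
  by rewrite -[k.+1]add1n -[(_ %% m).+1]add1n -[RHS]modnDmr modn_dvdm // modnDmr.
rewrite -[k.+1]add1n -[k.+2]add2n -!modS add1n add2n.
have : (k %% m < m)%N by rewrite ltn_mod.
move: (k %% m)%N => {modS}k lt_km.
case/dvdnP: m3 => q Dm; rewrite mulnC in Dm.
have [lt_k2|le_k2] := ltnP k.+2 m.
- rewrite !(@modn_small _ m); try lia.
  elim/mod3_ind: k lt_km lt_k2 => k lt_km lt_k2.
  + have -> : ((3 * k).+1 %% 3 == 0)%N = false by lia.
    by rewrite rim0 rim1 rim2 /=; field.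
  + have -> : ((3 * k).+2 %% 3 == 0)%N = false by lia.
    have -> : ((3 * k).+3 = 3 * k.+1)%N by lia.
    by rewrite rim0 rim1 rim2 /=; field.
  + have -> : ((3 * k).+3 %% 3 == 0)%N by lia.
    have -> : ((3 * k).+3 = 3 * k.+1)%N by lia.
    by rewrite rim0 rim1 rim2 muln_eq0 /=; field.
- case: q Dm => [|q] Dm; first by lia.
  (* Only the windows starting at m - 2 and m - 1 wrap around. *)
  have /orP[/eqP Dk|/eqP Dk] : (k == (3 * q).+1) || (k == (3 * q).+2) by lia.
  + have -> : (k.+2 %% m = 3 * 0)%N by rewrite (_ : k.+2 = m) ?modnn; lia.
    rewrite !(@modn_small _ m); try lia.
    have -> : (k.+1 %% 3 == 0)%N = false by lia.
    by rewrite Dk rim0 rim1 rim2 Dm /=; field.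
  + have -> : (k.+2 %% m = (3 * 0).+1)%N.
      by rewrite (_ : k.+2 = m + 1)%N ?modnDl ?modn_small; lia.
    have -> : (k.+1 %% m = 3 * 0)%N by rewrite (_ : k.+1 = m) ?modnn; lia.
    have -> : (k.+1 %% 3 == 0)%N by lia.
    by rewrite Dk rim0 rim1 rim2 Dm /=; field.
Qed.

End Rim.

(** * Entries of circulant matrices *)

Lemma iter_cyclic_shift (T : Type) (m k : nat) (f : nat -> T) (j : 'I_m) :
  (k <= m)%N ->
  iter k (@cyclic_shift T m) (\row_i f i) 0 j = f ((j + (m - k)) %% m)%N.
Proof.
elim: k j => [|k IHk] j lt_km /=.
  by rewrite mxE subn0 modnDr modn_small.
rewrite mxE IHk ?(ltnW lt_km) //=; congr f.
rewrite modnDml -(modnDr (j + (m - k.+1)) m); congr (_ %% _)%N.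
by have := ltn_ord j; lia.
Qed.

Lemma CircE (T : Type) (m : nat) (f : nat -> T) (i j : 'I_m) :
  Circ (\row_k f k) i j = f ((j + (m - i)) %% m)%N.
Proof. by rewrite mxE iter_cyclic_shift // ltnW. Qed.

(** The difference j - i modulo m. For fixed [j] it is an involution in [i], which turns sums down a
    column of a circulant into sums along its first row. *)
Definition circ_diff (m : nat) (j i : 'I_m) : 'I_m :=
  Ordinal (ltn_pmod (j + (m - i)) (leq_ltn_trans (leq0n i) (ltn_ord i))).

Lemma circ_diff_eq0 (m : nat) (i j : 'I_m) :
  ((j + (m - i)) %% m == 0)%N = (i == j).
Proof.
have lt_im := ltn_ord i; have lt_jm := ltn_ord j.
rewrite -val_eqE -[0%N](mod0n m) -(eqn_modDl i) addn0 addnCA subnKC 1?ltnW //.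
by rewrite modnDr !modn_small // eq_sym.
Qed.

Lemma circ_diffK (m : nat) (j : 'I_m) : involutive (circ_diff j).
Proof.
move=> i; apply: val_inj => /=.
have lt_im := ltn_ord i; have lt_jm := ltn_ord j.
have [le_ij|lt_ij] := leqP i j.
  have -> : ((j + (m - i)) %% m = j - i)%N.
    by rewrite (_ : j + (m - i) = j - i + m)%N ?modnDr ?modn_small; lia.
  by rewrite (_ : j + (m - (j - i)) = i + m)%N ?modnDr ?modn_small; lia.
rewrite (@modn_small (j + (m - i))); last by lia.
by rewrite modn_small; lia.
Qed.

(** * Kernel vectors and rank of the circulant and of the bordered matrix *)

Section RimCirculant.
Variables (R : realFieldType) (m : nat).
Hypotheses (m3 : (3 %| m)%N) (m_gt0 : (0 < m)%N).

Let C : 'M[R]_m := Circ (\row_j rim R m j).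

Let q : nat := (m %/ 3)%N.

Let Dm : m = (3 * q)%N.
Proof. by rewrite mulnC divnK. Qed.

Lemma circ_rim_class (c : nat) (j : 'I_m) : (c < 3)%N ->
  \sum_(i < m | (i %% 3 == c)%N) C i j = q%:R.
Proof.
move=> lt_c3.
rewrite (reindex_inj (inv_inj (@circ_diffK m j))) /=.
(* After reindexing, the class of [c] becomes that of j - c, written [j + 2 * c] to avoid truncated
   subtraction; the reduction modulo m is harmless as 3 divides m. *)
rewrite -(@sum_rim_class R q ((j + 2 * c) %% 3)) ?ltn_mod // -Dm.
apply: eq_big => [i|i _].
  have lt_im := ltn_ord i; rewrite modn_dvdm //.
  by apply/idP/idP; lia.
rewrite CircE; congr (rim R m _).
by have /(congr1 val) := circ_diffK j i.
Qed.

Lemma circ_rim_colsum (j : 'I_m) : \sum_(i < m) C i j = m%:R.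
Proof.
pose cl (i : 'I_m) : 'I_3 := inord (i %% 3).
rewrite (partition_big cl predT) //= [in RHS]Dm natrM.
under eq_bigr => c _.
  rewrite (eq_bigl (fun i : 'I_m => i %% 3 == c)%N); first last.
    by move=> i; rewrite -val_eqE /= inordK // ltn_mod.
  rewrite circ_rim_class //; over.
by rewrite sumr_const card_ord mulr_natl.
Qed.

(** A basis of the functions of the residue that sum to zero over the three residues, normalized so
    that its first two columns form the identity. *)
Definition residue_mx : 'M[R]_(2, m) :=
  \matrix_(c, i) ((i %% 3 == c)%N%:R - (i %% 3 == 2)%N%:R).

Lemma residue_mx_const : residue_mx *m const_mx 1 = 0 :> 'cV_2.
Proof.
apply/matrixP => c k; rewrite !mxE.
under eq_bigr do rewrite !mxE mulr1.
have class_size d : (d < 3)%N -> \sum_(i < m) (i %% 3 == d)%N%:R = q%:R :> R.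
  move=> lt_d3; under eq_bigr do rewrite mulrb.
  rewrite -big_mkcond /= Dm (sum_mod3 q (fun=> 1) lt_d3).
  by rewrite sumr_const_nat subn0.
by rewrite sumrB !class_size ?subrr // (ltn_trans (ltn_ord c)).
Qed.

Lemma residue_mx_circ : residue_mx *m C = 0.
Proof.
apply/matrixP => c j; rewrite !mxE.
under eq_bigr do rewrite mxE mulrBl !mulr_natl !mulrb.
rewrite sumrB -!big_mkcond /= !circ_rim_class ?subrr //.
exact: ltn_trans (ltn_ord c) _.
Qed.

Lemma sum_delta (F : 'I_m -> R) (k : 'I_m) : \sum_i F i * (i == k)%:R = F k.
Proof.
by rewrite (bigD1 k) //= eqxx mulr1 big1 ?addr0 // => i /negPf->; rewrite mulr0.
Qed.

Lemma rank_circ_rim : (m - 2 <= \rank C)%N.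
Proof.
(* [B] is the circulant of x^-1 + 1 + x. The product [residue_mx^T *m G] has entries 9[i = j mod 3]
   - 3 and factors through dimension 2. *)
pose B : 'M[R]_m :=
  \matrix_(k, j) ((k == ord_pred j)%:R + (k == j)%:R + (k == ordS j)%:R).
pose G : 'M[R]_(2, m) := \matrix_(c, j) (9 * (j %% 3 == c)%N%:R - 3).
have CB : C *m B + residue_mx^T *m G = (3 * m%:R)%:M.
  apply/matrixP => i j; rewrite !mxE.
  under eq_bigr do rewrite [B _ _]mxE !mulrDr.
  rewrite !big_split /= !sum_delta !CircE big_ord_recl big_ord1 !mxE /=.
  (* The window starts at j - 1 - i; adding m first keeps the predecessor correct at [j = 0]. *)
  have := rim_three_term R ((j + m).-1 + (m - i)) m3 m_gt0.
  have -> : ((j + m).-1 + (m - i)).+2 = (m + (j.+1 + (m - i)))%N by lia.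
  have -> : ((j + m).-1 + (m - i)).+1 = (m + (j + (m - i)))%N by lia.
  rewrite !modnDl !modnDml => ->.
  have lt_im := ltn_ord i; have lt_jm := ltn_ord j.
  rewrite circ_diff_eq0.
  have -> : ((m + (j + (m - i))) %% 3 == 0)%N = (i %% 3 == j %% 3)%N by lia.
  have : (i %% 3 < 3)%N by rewrite ltn_mod.
  have : (j %% 3 < 3)%N by rewrite ltn_mod.
  case: (i == j); rewrite ?mulr1n ?mulr0n;
    case: (j %% 3)%N => [|[|[|//]]] _; case: (i %% 3)%N => [|[|[|//]]] _ /=; ring.
rewrite leq_subLR; apply: (@leq_trans (\rank ((3 * m%:R)%:M : 'M[R]_m))).
  by rewrite -scalemx1 mxrank_scale_nz ?mxrank1 ?mulf_neq0 ?pnatr_eq0 -?lt0n.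
rewrite -CB addnC; apply: leq_trans (mxrank_add _ _) (leq_add _ _).
  exact: mxrankM_maxl.
exact: leq_trans (mxrankM_maxl _ _) (rank_leq_col _).
Qed.

Lemma rank_bordered_circ_rim :
  \rank (block_mx m%:R%:M (- const_mx 1) (- const_mx 1) (m%:R^-1 *: C)
          : 'M_(1 + m)) = (m - 2)%N.
Proof.
have m_neq0 : m%:R != 0 :> R by rewrite pnatr_eq0 -lt0n.
have le_2m : (2 <= m)%N by lia.
set L := block_mx _ _ _ _.
(* The rows of [K] are the three kernel vectors; its right inverse [N] shows that they are
   independent. *)
pose K : 'M[R]_(1 + 2, 1 + m) := block_mx 1%:M (const_mx 1) 0 residue_mx.
pose E : 'M[R]_(m, 2) := \matrix_(i, c) (i == widen_ord le_2m c)%:R.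
pose N : 'M[R]_(1 + m, 1 + 2) := block_mx 1%:M (- const_mx 1) 0 E.
have KL : K *m L = 0.
  rewrite mulmx_block !mul1mx !mul0mx !add0r !mulmxN residue_mx_const oppr0.
  rewrite -!scalemxAr residue_mx_circ scaler0.
  have -> : const_mx 1 *m C = m%:R *: const_mx 1 :> 'rV_m.
    apply/rowP => j; rewrite !mxE mulr1 -(circ_rim_colsum j).
    by apply: eq_bigr => i _; rewrite mxE mul1r.
  rewrite scalerA mulVf // scale1r addNr.
  have -> : (const_mx 1 : 'rV[R]_m) *m const_mx 1 = m%:R%:M :> 'M_1.
    apply/matrixP => i j; rewrite !mxE !ord1 eqxx.
    by under eq_bigr do rewrite !mxE mulr1; rewrite sumr_const card_ord.
  by rewrite subrr block_mx0.
have KN : K *m N = 1%:M.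
  rewrite mulmx_block !mul1mx !mul0mx !mulmx0 !addr0 !add0r.
  have -> : const_mx 1 *m E = const_mx 1 :> 'rV_2.
    apply/rowP => c; rewrite !mxE.
    by under eq_bigr do rewrite [E _ _]mxE; rewrite sum_delta mxE.
  have -> : residue_mx *m E = 1%:M.
    apply/matrixP => c d; rewrite !mxE.
    under eq_bigr do rewrite [E _ _]mxE.
    rewrite sum_delta mxE -val_eqE /=.
    by case: c d => [[|[|[]]]] // ? [[|[|[]]]] //= ?; rewrite ?subr0.
  by rewrite addNr -scalar_mx_block.
apply/eqP; rewrite eqn_leq; apply/andP; split.
  have := mulmx0_rank_max KL.
  have : (3 <= \rank K)%N by rewrite -(@mxrank1 R 3) -KN mxrankM_maxl.
  by lia.
apply: leq_trans rank_circ_rim _.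
(* For the lower bound, [C] is a multiple of the rim block of [L]. *)
have <- : m%:R *: (row_mx 0 1%:M *m L *m col_mx 0 1%:M) = C.
  rewrite mul_row_block mul_row_col !mul0mx !mul1mx !mulmx0 mulmx1 !add0r.
  by rewrite scalerA mulfV // scale1r.
rewrite mxrank_scale_nz //.
exact: leq_trans (mxrankM_maxl _ _) (mxrankM_maxr _ _).
Qed.

End RimCirculant.

(** * The first row of [P] in terms of [rim] *)

Lemma sum_delta3 (R : pzRingType) (N e : nat) (F : nat -> R) :
  \sum_(1 <= k < N.+1) F k * (e == 3 * k)%N%:R
  = if (e %% 3 == 0)%N && (0 < e <= 3 * N)%N then F (e %/ 3)%N else 0.
Proof.
elim: N => [|N IHN]; first by rewrite big_geq //; case: ifP => //; lia.
rewrite big_nat_recr //= {}IHN.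
have [->|ne_e] := eqVneq e (3 * N.+1)%N.
  rewrite mulr1 mulKn //.
  by do 2!case: ifP => //; try lia; rewrite add0r.
rewrite mulr0 addr0; do 2!case: ifP => //; lia.
Qed.

Section FirstRow.
Variables (R : realFieldType) (n : nat).
Hypotheses (n_ge10 : (10 <= n)%N) (n_mod3 : (n %% 3 = 1)%N).

(* The vectors c_k only see the cyclic distance of a coordinate from the first one. *)
Lemma c_vecE (k : nat) (j : 'I_(n - 1)) : (0 < k)%N -> (2 * k < n - 1)%N ->
  c_vec R n k j 0 = (minn j (n - 1 - j) == k)%:R.
Proof.
move=> k_gt0 lt_k; have lt_j := ltn_ord j; rewrite !mxE -natrD; congr _%:R.
by do 3!case: eqP; lia.
Qed.

(** Both sides depend only on the cyclic distance [d] of [j] from 0, and each sum has at most one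
    nonzero term at [d]. The correction at 0 comes from 2n - n^2 = 1 - (n - 1)^2. *)
Lemma first_row (j : 'I_(n - 1)) :
  (if odd n then z2 R n else z1 R n) j 0
  = rim R (n - 1) j - (n - 1)%:R ^+ 2 * (j == 0 :> nat)%:R.
Proof.
have lt_j := ltn_ord j.
have rim_minn : rim R (n - 1) j = rim R (n - 1) (minn j (n - 1 - j)).
  rewrite /minn; case: ifP => // _; rewrite rim_sym //; last exact: ltnW.
  by apply/dvdnP; exists ((n - 1) %/ 3)%N; lia.
set d := minn _ _ in rim_minn.
have addE (u v : 'cV[R]_(n - 1)) : (u + v) j 0 = u j 0 + v j 0 by rewrite mxE.
have oppE (u : 'cV[R]_(n - 1)) : (- u) j 0 = - u j 0 by rewrite mxE.
have scaleE a (u : 'cV[R]_(n - 1)) : (a *: u) j 0 = a * u j 0 by rewrite mxE.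
have basisE i : basis_vec R (n - 1) i j 0 = (j.+1 == i)%:R by rewrite mxE.
have d_eq0 : (j == 0 :> nat) = (d == 0)%N by rewrite /d; lia.
have e1E : (j.+1 == 1%N) = (d == 0)%N by rewrite -d_eq0.
have d_le : (2 * d <= n - 1)%N by rewrite /d; lia.
have n_eq : n%:R = (n - 1)%:R + 1 :> R by rewrite natrB ?subrK //; lia.
have if3F e N (x : R) : (e %% 3 != 0)%N || (e == 0)%N || (3 * N < e)%N ->
    (if (e %% 3 == 0)%N && (0 < e <= 3 * N)%N then x else 0) = 0.
  by case: ifP => //; lia.
have if3T e N (x : R) : (e %% 3 = 0)%N -> (0 < e <= 3 * N)%N ->
    (if (e %% 3 == 0)%N && (0 < e <= 3 * N)%N then x else 0) = x.
  by move=> -> ->.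
rewrite rim_minn.
case: ifP => odd_n; [rewrite /z2|rewrite /z1].
- rewrite !addE !summxE !scaleE basisE e1E d_eq0.
  under eq_big_nat => k k_bd.
    rewrite addE oppE !scaleE !c_vecE -/d; try lia.
    (* Shifting [d] brings the indicators to the form of [sum_delta3]; no truncation occurs since k
       is at least 1. *)
    have -> : (d == 3 * k - 2 = (d.+2 == 3 * k))%N by lia.
    have -> : (d == 3 * k - 1 = (d.+1 == 3 * k))%N by lia.
    over.
  rewrite sumrB !sum_delta3.
  under eq_big_nat => k k_bd.
    rewrite c_vecE -/d; try lia.
    rewrite -[_%:R]mul1r.
    over.
  rewrite (@sum_delta3 R _ _ (fun=> 1)) basisE.
  have -> : (j.+1 == (n + 1) %/ 2 = (2 * d == n - 1))%N by lia.
  elim/mod3_ind: d d_le {rim_minn e1E d_eq0} => k d_le.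
  + rewrite !(if3F (3 * k).+2%N) ?(if3F (3 * k).+1%N); try lia.
    rewrite rim0; case: k d_le => [|k] d_le.
      have -> : (2 * (3 * 0) == n - 1)%N = false by lia.
      by rewrite n_eq mulr0n /=; ring.
    (* At distance (n - 1)/2 the entry 1 comes from the single basis vector, as the sum of the
       [c_vec] stops just before. *)
    have [k_eq|k_neq] := boolP (2 * (3 * k.+1) == n - 1)%N.
      by rewrite if3F ?muln_eq0 /=; [ring|lia].
    by rewrite if3T ?muln_eq0 /=; [ring|lia..].
  + rewrite !(if3F (3 * k).+1%N) ?(if3F (3 * k).+2%N); try lia.
    have -> : (2 * (3 * k).+1 == n - 1)%N = false by lia.
    rewrite if3T; try lia.
    have -> : ((3 * k).+3 %/ 3 = k.+1)%N by lia.
    by rewrite rim1 /a_coef n_eq /= ?mulr0n; field.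
  + rewrite !(if3F (3 * k).+2%N) ?(if3F (3 * k).+4%N); try lia.
    have -> : (2 * (3 * k).+2 == n - 1)%N = false by lia.
    rewrite if3T; try lia.
    have -> : ((3 * k).+3 %/ 3 = k.+1)%N by lia.
    by rewrite rim2 /b_coef n_eq /= ?mulr0n; field.
- rewrite addE c_vecE -/d; try lia.
  rewrite addE summxE scaleE basisE e1E d_eq0.
  under eq_big_nat => k k_bd.
    rewrite addE addE oppE !scaleE !c_vecE -/d; try lia.
    have -> : (d == 3 * k - 2 = (d.+2 == 3 * k))%N by lia.
    have -> : (d == 3 * k - 1 = (d.+1 == 3 * k))%N by lia.
    rewrite -[X in _ + X]mul1r.
    over.
  rewrite big_split sumrB !sum_delta3 /=.
  elim/mod3_ind: d d_le {rim_minn e1E d_eq0} => k d_le.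
  + rewrite !(if3F (3 * k).+2%N) ?(if3F (3 * k).+1%N); try lia.
    have -> : (3 * k == n %/ 2 - 1)%N = false by lia.
    rewrite rim0; case: k d_le => [|k] d_le; first by rewrite n_eq mulr0n /=; ring.
    by rewrite if3T ?muln_eq0 /=; [ring|lia..].
  + rewrite !(if3F (3 * k).+1%N) ?(if3F (3 * k).+2%N); try lia.
    (* The largest distance lies beyond the sum; there [rim] takes the value 1, the coefficient of
       the extra [c_vec]. *)
    have [/eqP k_eq|k_neq] := boolP ((3 * k).+1 == n %/ 2 - 1)%N.
      rewrite if3F; last by lia.
      have -> : (n - 1 = 6 * k + 3)%N by lia.
      by rewrite rim1 /= ?mulr0n; field.
    rewrite if3T; try lia.
    have -> : ((3 * k).+3 %/ 3 = k.+1)%N by lia.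
    by rewrite rim1 /a_coef n_eq /= ?mulr0n; field.
  + rewrite !(if3F (3 * k).+2%N) ?(if3F (3 * k).+4%N); try lia.
    have -> : ((3 * k).+2 == n %/ 2 - 1)%N = false by lia.
    rewrite if3T; try lia.
    have -> : ((3 * k).+3 %/ 3 = k.+1)%N by lia.
    by rewrite rim2 /b_coef n_eq /= ?mulr0n; field.
Qed.

End FirstRow.

(** * From [P] to the rank of [Lhat] *)

Lemma P_mxE (R : realFieldType) (n : nat) :
  (10 <= n)%N -> (n %% 3 = 1)%N ->
  P_mx R n = (3 * (n - 1)%:R)^-1 *:
    (Circ (\row_j rim R (n - 1) j) - (n - 1)%:R ^+ 2 *: 1%:M).
Proof.
move=> n_ge10 n_mod3.
have n1E : n%:R - 1 = (n - 1)%:R :> R by rewrite natrB //; lia.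
rewrite /P_mx n1E; congr (_ *: _).
pose f j : R := rim R (n - 1) j - (n - 1)%:R ^+ 2 * (j == 0)%N%:R.
have -> : (if odd n then z2 R n else z1 R n)^T = \row_j f j.
  by apply/rowP => j; rewrite [LHS]mxE first_row // mxE.
apply/matrixP => i j; rewrite CircE /f circ_diff_eq0.
by rewrite [RHS]mxE CircE !mxE; case: (i == j).
Qed.

Theorem theorem6p14 (R : realFieldType) (n : nat)
  (hn : (10 <= n)%N) (hn3 : n = 1 %[mod 3]) :
  \rank (Lhat R n) = (n - 3)%N.
Proof.
have m3 : (3 %| n - 1)%N by rewrite -eqn_mod_dvd ?hn3 //; lia.
have m_gt0 : (0 < n - 1)%N by lia.
have m_neq0 : (n - 1)%:R != 0 :> R by rewrite pnatr_eq0 -lt0n.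
have -> : (n - 3 = n - 1 - 2)%N by lia.
rewrite -(rank_bordered_circ_rim R m3 m_gt0).
rewrite -(@mxrank_scale_nz _ _ _ 3^-1 (block_mx _ _ _ _)) ?invr_eq0 ?pnatr_eq0 //.
congr (\rank _).
have n1E : n%:R - 1 = (n - 1)%:R :> R by rewrite natrB //; lia.
rewrite /Lhat n1E P_mxE // scalar_mx_block !scale_block_mx opp_block_mx.
rewrite !add_block_mx !scaler0 !oppr0 !addr0 !add0r trmx_const.
congr block_mx; rewrite ?scalerN //.
  by rewrite scalemx1 scale_scalar_mx mulrC.
(* On the rim block, the diagonal term (n - 1)/3 cancels the multiple of the identity inside [P]. *)
apply/matrixP => i j; rewrite !mxE; field.
exact: m_neq0.
Qed.
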